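(* Let $m\geq 1$ and $n\geq 1$ be integers. The graph $m\Gamma(\mathbb{Z}_9)+n\Gamma(\mathbb{Z}_4)$ (the join of $m\Gamma(\mathbb{Z}_9)$ and $n\Gamma(\mathbb{Z}_4)$) admits a distance antimagic labeling if and only if $n=1$.
   Context: For an integer $n \geq 2$, the zero-divisor graph $\Gamma(\mathbb{Z}_n)$ is the simple graph whose vertex set is the set of nonzero zero-divisors of the ring $\mathbb{Z}_n$, two distinct vertices $u,v$ being adjacent iff $uv \equiv 0 \pmod n$. For a graph $H$ and positive integer $k$, $kH$ denotes the disjoint union of $k$ copies of $H$. For graphs $G,H$, the join $G+H$ is the graph obtained from the disjoint union of $G$ and $H$ by adding every edge between a vertex of $G$ and a vertex of $H$. A distance antimagic labeling (DAML) of a graph $G$ with $N$ vertices is a bijection $f:V(G)\to\{1,\dots,N\}$ such that the weights $w(v)=\sum_{u\in N(v)} f(u)$, where $N(v)$ is the open neighbourhood of $v$, are pairwise distinct over all vertices $v$. A graph admits DAML if such a labeling exists. *)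

(* Defs.v *)
From HB Require Import structures.
From mathcomp Require Import all_boot all_order all_algebra.

Set Implicit Arguments.
Unset Strict Implicit.
Unset Printing Implicit Defensive.

Import GRing.Theory.

Record sgraph := SGraph {
  vertex :> finType;
  edge : rel vertex;
  edge_sym : symmetric edge;
  edge_irrefl : irreflexive edge
}.

Section ZeroDivisorGraph.

Variable n : nat.

Local Open Scope ring_scope.

Definition nonzero_zero_divisor (x : 'Z_n) : bool :=
  (x != 0) && [exists y : 'Z_n, (y != 0) && (x * y == 0)].

Definition zdg_vertex : finType := {x : 'Z_n | nonzero_zero_divisor x}.

Definition zdg_edge : rel zdg_vertex :=
  fun u v => (u != v) && (val u * val v == 0).

Lemma zdg_edge_sym : symmetric zdg_edge.
Proof. by move=> u v; rewrite /zdg_edge eq_sym mulrC. Qed.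

Lemma zdg_edge_irrefl : irreflexive zdg_edge.
Proof. by move=> u; rewrite /zdg_edge eqxx. Qed.

(* This is the graph of the ring of integers mod n only for n >= 2, since
   'Z_0 and 'Z_1 are both the integers mod 2. *)
Definition zero_divisor_graph : sgraph := SGraph zdg_edge_sym zdg_edge_irrefl.

End ZeroDivisorGraph.

Section Copies.

Variables (k : nat) (H : sgraph).

Definition copies_edge : rel ('I_k * H)%type :=
  fun u v => (u.1 == v.1) && edge u.2 v.2.

Lemma copies_edge_sym : symmetric copies_edge.
Proof. by move=> u v; rewrite /copies_edge eq_sym edge_sym. Qed.

Lemma copies_edge_irrefl : irreflexive copies_edge.
Proof. by move=> u; rewrite /copies_edge edge_irrefl andbF. Qed.

Definition copies : sgraph := SGraph copies_edge_sym copies_edge_irrefl.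

End Copies.

Section Join.

Variables G H : sgraph.

Definition join_edge : rel (G + H)%type := fun u v =>
  match u, v with
  | inl x, inl y => edge x y
  | inr x, inr y => edge x y
  | _, _ => true
  end.

Lemma join_edge_sym : symmetric join_edge.
Proof. by move=> [x|x] [y|y] //=; rewrite edge_sym. Qed.

Lemma join_edge_irrefl : irreflexive join_edge.
Proof. by move=> [x|x] /=; rewrite edge_irrefl. Qed.

Definition join : sgraph := SGraph join_edge_sym join_edge_irrefl.

End Join.

Definition weight (G : sgraph) (f : G -> nat) (v : G) : nat :=
  \sum_(u | edge v u) f u.

Definition is_DAML (G : sgraph) (f : G -> nat) : Prop :=
  [/\ injective f,
      forall k : nat, (exists v, f v = k) <-> 1 <= k <= #|G|
    & injective (weight f)].

Definition admits_DAML (G : sgraph) : Prop := exists f : G -> nat, is_DAML f.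

(* Main.v *)
Require Import Defs.
From HB Require Import structures.
From mathcomp Require Import all_boot all_order all_algebra.

(**
  The graph Gamma(Z_9) is a single edge {3, 6} and Gamma(Z_4) is the single
  vertex 2, so the graph in question joins m disjoint edges to n isolated
  vertices.  Two of those n vertices would have the same neighbourhood, hence
  the same weight, which forces n = 1.  Conversely, for n = 1 give the label 1
  to the vertex of Gamma(Z_4) and the labels 2, 3, ... to the others in any
  order: a vertex x with partner x' has weight f(x') + 1, and the central vertex
  has weight at least f(x') + f(x) > f(x') + 1.
*)

Set Implicit Arguments.
Unset Strict Implicit.
Unset Printing Implicit Defensive.

Definition edgeless (G : sgraph) : Prop := forall u v : G, edge u v = false.

(** The whole graph is 1-regular: since [edge] is symmetric and irreflexive, passing to the partner
    [u'] is an involution without fixed points. *)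
Definition perfect_matching (G : sgraph) : Prop :=
  forall u : G, exists u', forall v, edge u v = (v == u').

Lemma card1_edgeless (G : sgraph) : #|G| = 1 -> edgeless G.
Proof.
move=> /eqP/fintype1P[x Gx] u v.
by rewrite (Gx u) (Gx v) edge_irrefl.
Qed.

Lemma copies_edgeless (k : nat) (H : sgraph) :
  edgeless H -> edgeless (copies k H).
Proof. by move=> eH u v; rewrite /= /copies_edge eH andbF. Qed.

Lemma copies_matching (k : nat) (H : sgraph) :
  perfect_matching H -> perfect_matching (copies k H).
Proof.
move=> mH [i x]; have [x' ex] := mH x; exists (i, x') => -[j y].
by rewrite /= /copies_edge /= ex xpair_eqE eq_sym.
Qed.

Lemma card_copies (k : nat) (H : sgraph) : #|copies k H| = k * #|H|.
Proof. by rewrite card_prod card_ord. Qed.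

Lemma DAML_join_edgeless (G H : sgraph) :
  edgeless H -> admits_DAML (join G H) -> #|H| <= 1.
Proof.
move=> eH [f [_ _ w_inj]]; rewrite leqNgt; apply/negP => /card_gt1P.
case=> x [y [_ _ /negP]]; apply; apply/eqP.
suff: inr x = inr y :> join G H by case.
(* In the join, [x] and [y] are both adjacent to exactly the vertices of [G]. *)
by apply: w_inj; apply: eq_bigl => -[z|z] //=; rewrite !eH.
Qed.

Lemma DAML_join_matching (G H : sgraph) :
  perfect_matching G -> #|H| = 1 -> admits_DAML (join G H).
Proof.
move=> mG cH; have eH := card1_edgeless cH.
have Hsub (y y' : H) : y = y' by have /eqP/fintype1P[z Hz] := cH; rewrite !Hz.
(* Ranks start at 0, so the shift by 2 leaves exactly the label 1 for the vertex of [H]. *)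
pose f (v : join G H) := if v is inl x then (enum_rank x).+2 else 1.
have f_inj : injective f.
  move=> [x|x] [y|y] //= => [[/val_inj/enum_rank_inj ->]|_] //.
  by rewrite (Hsub x y).
have w_inl x x' : (forall v, edge x v = (v == x')) ->
    weight f (inl x) = f (inl x') + 1.
  move=> ex; rewrite /weight big_sumType /=; congr (_ + _).
    by rewrite (eq_bigl _ _ ex) big_pred1_eq.
  by rewrite sum_nat_const muln1 cH.
have w_inr y : weight f (inr y) = \sum_(x : G) f (inl x).
  rewrite /weight big_sumType /= [X in _ + X]big1 ?addn0 // => v.
  by rewrite eH.
have w_lt x y : weight f (inl x) < weight f (inr y).
  have [x' ex] := mG x; rewrite (w_inl _ _ ex) w_inr.
  have x'x : x != x' by rewrite -ex edge_irrefl.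
  (* After splitting off the terms of [x'] and [x] and cancelling the first, it remains that the
     label of [x] exceeds 1. *)
  by rewrite (bigD1 x') // (bigD1 x) //= -addnS leq_add2l ltn_addr.
exists f; split=> //.
- move=> k; rewrite card_sum cH addn1; split=> [[[x|y] <-]|] //=.
    by rewrite !ltnS.
  case: k => [|[|k]] //=.
    by move=> _; have /eqP/fintype1P[z _] := cH; exists (inr z).
  by rewrite !ltnS => kG; exists (inl (enum_val (Ordinal kG))); rewrite /= enum_valK.
- move=> [x|x] [y|y] => [|e|e|_]; last by rewrite (Hsub x y).
  + have [x' ex] := mG x; have [y' ey] := mG y.
    rewrite (w_inl _ _ ex) (w_inl _ _ ey) => /addIn/f_inj [x'y'].
    (* Equal weights give [x] and [y] the same partner [x'], whose only neighbour [z] must be both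
       of them. *)
    have [z ez] := mG x'.
    have /eqP -> : x == z by rewrite -ez edge_sym ex.
    suff /eqP -> : y == z by [].
    by rewrite -ez edge_sym ey x'y'.
  + by have := w_lt x y; rewrite e ltnn.
  + by have := w_lt y x; rewrite e ltnn.
Qed.

Lemma nonzero_zero_divisor9 (x : 'Z_9) :
  nonzero_zero_divisor x = (x == 3 :> nat) || (x == 6 :> nat).
Proof.
apply/idP/idP.
  case/andP=> x0 /existsP[y /andP[y0]]; move: x0 y0.
  by case: x => [[|[|[|[|[|[|[|[|[|x]]]]]]]]] ?] //;
     case: y => [[|[|[|[|[|[|[|[|[|y]]]]]]]]] ?].
case: x => [[|[|[|[|[|[|[|x]]]]]]] ?] // _; apply/andP; split=> //;
  (* The witness 3 serves both residues: 3 * 3 and 6 * 3 are multiples of 9. *)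
  by apply/existsP; exists (inord 3); rewrite -!val_eqE /= inordK.
Qed.

Lemma nonzero_zero_divisor4 (x : 'Z_4) :
  nonzero_zero_divisor x = (x == inord 2).
Proof.
rewrite -val_eqE /= inordK //; apply/idP/idP.
  case/andP=> x0 /existsP[y /andP[y0]]; move: x0 y0.
  by case: x => [[|[|[|[|x]]]] ?] //; case: y => [[|[|[|[|y]]]] ?].
case: x => [[|[|[|x]]] ?] // _; apply/andP; split=> //.
by apply/existsP; exists (inord 2); rewrite -!val_eqE /= inordK.
Qed.

Lemma zdg9_matching : perfect_matching (zero_divisor_graph 9).
Proof.
move=> [x zx].
(* Negation swaps 3 and 6, so the partner of [x] is [- x]; although 3 * 3 and 6 * 6 vanish too,
   adjacency requires distinct vertices. *)
have zNx : nonzero_zero_divisor (- x)%R.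
  move: (zx); rewrite !nonzero_zero_divisor9.
  by case: x {zx} => [[|[|[|[|[|[|[|x]]]]]]] ?].
exists (Sub (- x)%R zNx) => -[y zy].
rewrite /= /zdg_edge -!val_eqE /=; move: (zx) (zy).
rewrite !nonzero_zero_divisor9.
by case: x {zx zNx} => [[|[|[|[|[|[|[|x]]]]]]] ?] //;
   case: y {zy} => [[|[|[|[|[|[|[|y]]]]]]] ?].
Qed.

Lemma card_zdg4 : #|zero_divisor_graph 4| = 1.
Proof.
by rewrite card_sig; apply: eq_card1 => x; rewrite inE nonzero_zero_divisor4.
Qed.

Theorem theorem2p4 (m n : nat) (hm : 1 <= m) (hn : 1 <= n) :
  admits_DAML (join (copies m (zero_divisor_graph 9))
                    (copies n (zero_divisor_graph 4))) <-> n = 1.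
Proof.
have cn : #|copies n (zero_divisor_graph 4)| = n.
  by rewrite card_copies card_zdg4 muln1.
split=> [/DAML_join_edgeless|n1].
  rewrite cn => le_n1; apply/eqP; rewrite eqn_leq hn andbT; apply: le_n1.
  exact/copies_edgeless/card1_edgeless/card_zdg4.
apply: DAML_join_matching; last by rewrite cn.
exact/copies_matching/zdg9_matching.
Qed.
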